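(* Let $M=2$. Then $P(W\text{ is }M\text{-seen in }Y)=0$ for every infinite word $W\in\{0,1\}^{\mathbb N}$, and thus $P(X\text{ is }M\text{-seen in }Y)=0$.
   Context: $X=(X_1,X_2,\dots)$ and $Y=(Y_1,Y_2,\dots)$ are independent i.i.d. sequences of Bernoulli random variables with $P(X_i=1)=P(Y_j=1)=\tfrac12$. For a positive integer $M$, an infinite word $W=(w_1,w_2,\dots)\in\{0,1\}^{\mathbb N}$ is $M$-seen in $Y$ if there is a sequence of integers $(m_i:i\ge1)$ such that, with $m_0=0$, $1\le m_i-m_{i-1}\le M$ and $Y_{m_i}=w_i$ for every $i\ge1$. The same definition applies to the random word $W=X$. *)

(* Defs.v *)
From mathcomp Require Import all_boot all_order all_algebra finmap.
From mathcomp Require Import all_classical all_reals all_analysis.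

Set Implicit Arguments.
Unset Strict Implicit.
Unset Printing Implicit Defensive.

Import Order.TTheory GRing.Theory Num.Theory.

Local Open Scope classical_set_scope.
Local Open Scope ring_scope.

(* An infinite 0-1 sequence (w_1, w_2, ...) is encoded with a shift of the
   indices: w_i is [w i.-1], i.e. [w i] is w_(i+1). *)
Definition word : Type := nat -> bool.

(* Since the increments are positive and m_0 = 0, the integers m_i are natural
   numbers; [y (m i.+1).-1] is y_(m_(i+1)), the index being at least 1. *)
Definition seen (M : nat) (w y : word) : Prop :=
  exists m : nat -> nat, m 0%N = 0%N /\
    forall i : nat, (m i < m i.+1 <= m i + M)%N /\ y (m i.+1).-1 = w i.

Section sequences_of_random_variables.
Context {d : measure_display} {T : measurableType d} {R : realType}.
Variable P : probability T R.

Definition mutually_independent (Z : nat -> {RV P >-> bool}) : Prop :=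
  forall (J : {fset nat}) (B : nat -> set bool),
    (forall i, measurable (B i)) ->
    P (\bigcap_(i in [set` J]) (Z i @^-1` B i)) =
    (\prod_(i <- J) P (Z i @^-1` B i))%E.

(* The common law is determined by P(Z_i = 1) = 1/2, so this also contains the
   "identically distributed" part. *)
Definition iid_bernoulli_half (Z : nat -> {RV P >-> bool}) : Prop :=
  mutually_independent Z /\
  forall i, P (Z i @^-1` [set true]) = (2^-1)%:E.

Definition sigma_of (Z : nat -> {RV P >-> bool}) : set (set T) :=
  <<s \bigcup_i g_sigma_algebra_preimage (Z i) >>.

Definition independent_sequences (X Y : nat -> {RV P >-> bool}) : Prop :=
  forall A B : set T, sigma_of X A -> sigma_of Y B ->
    P (A `&` B) = (P A * P B)%E.

Definition sample_word (Z : nat -> {RV P >-> bool}) (t : T) : word := fun i => Z i t.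

(* P(E) = 0, where E being an event is part of the assertion: the measure [P]
   is a total function on sets. *)
Definition null_event (E : set T) : Prop := measurable E /\ P E = 0%E.

End sequences_of_random_variables.

(* Main.v *)
Require Import Defs.
From mathcomp Require Import all_boot all_order all_algebra finmap.
From mathcomp Require Import all_classical all_reals all_analysis.
From mathcomp Require Import zify lra.

(* After reading m letters of Y, let A_m be the set of all i such that the first
   i letters of w can be embedded with m_i = m.  Then A_(m+2) is the set of the
   i+1 with i in A_m or A_(m+1) and w_(i+1) = Y_(m+2), so that the weight
   |A_m| + 2 |A_(m+1)| is a supermartingale, whose expected loss at each step is
   the number of common elements of A_m and A_(m+1).  If a letter that extends
   an embedding ending at the current position is read twice, the two new sets
   intersect.  Hence, as long as the process is alive, the expected weight
   decreases by a constant over any four steps, and the probability of being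
   alive at time 4n is at most 32 / n, uniformly in w.  The uniformity gives the
   case of a random word by conditioning on its first 4n letters. *)

Import Order.TTheory GRing.Theory Num.Theory.

Local Open Scope classical_set_scope.

(** * Finite embeddings and the passage to infinite ones *)

(* The first [i] letters of [w] are embedded in the first [m] letters of [y],
   and [k] more letters of [w] are to be embedded. *)
Fixpoint embeds (w y : word) (i m k : nat) : bool :=
  if k is k'.+1 then
    (y m == w i) && embeds w y i.+1 m.+1 k'
    || (y m.+1 == w i) && embeds w y i.+1 m.+2 k'
  else true.

Lemma embedsS (w y : word) (k i m : nat) :
  embeds w y i m k.+1 -> embeds w y i m k.
Proof.
elim: k i m => [//|k IHk] i m /orP[] /andP[yw ywk] /=; rewrite yw.
  by rewrite (IHk _ _ ywk).
by rewrite (IHk _ _ ywk) orbT.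
Qed.

Lemma embeds_leq (w y : word) (i m k l : nat) :
  (k <= l)%N -> embeds w y i m l -> embeds w y i m k.
Proof.
move=> /subnK <-; elim: (l - k)%N => [//|j IHj]; rewrite addSn => /embedsS.
exact: IHj.
Qed.

Lemma eq_embeds (w w' y : word) (k i m : nat) :
  (forall j, (j < i + k)%N -> w j = w' j) ->
  embeds w y i m k = embeds w' y i m k.
Proof.
elim: k i m => [//|k IHk] i m ww' /=.
have wi : w i = w' i by apply: ww'; lia.
have wj j : (j < i.+1 + k)%N -> w j = w' j by move=> ?; apply: ww'; lia.
by rewrite wi !IHk.
Qed.

(* The induction step of Koenig's lemma. *)
Lemma embeds_all (w y : word) (i m : nat) :
  (forall k, embeds w y i m k) ->
  exists2 m', (m < m' <= m + 2)%N &
    y m'.-1 = w i /\ forall k, embeds w y i.+1 m' k.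
Proof.
move=> all_k.
have [[yw ywk]|no1] := pselect (y m = w i /\ forall k, embeds w y i.+1 m.+1 k).
  by exists m.+1; [lia | split].
have [[yw ywk]|no2] :=
    pselect (y m.+1 = w i /\ forall k, embeds w y i.+1 m.+2 k).
  by exists m.+2; [lia | split].
have fails m1 m2 : ~ (y m1 = w i /\ forall k, embeds w y i.+1 m2 k) ->
    exists k, ~~ ((y m1 == w i) && embeds w y i.+1 m2 k).
  move=> no; apply: contrapT => yes; apply: no.
  have yes' k : (y m1 == w i) && embeds w y i.+1 m2 k.
    by apply/negPn/negP => nk; apply: yes; exists k.
  by split=> [|k]; [have /andP[/eqP] := yes' 0%N | have /andP[]:= yes' k].
have [k1 /negP nk1] := fails _ _ no1; have [k2 /negP nk2] := fails _ _ no2.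
(* Embeddability decreases with the length, so at the larger of the two failing lengths both choices
   fail. *)
have /orP[] := all_k (maxn k1 k2).+1 => /andP[yw ywk].
- by case: nk1; rewrite yw (embeds_leq _ _ _ _ _ _ (leq_maxl k1 k2) ywk).
- by case: nk2; rewrite yw (embeds_leq _ _ _ _ _ _ (leq_maxr k1 k2) ywk).
Qed.

(** Compactness: each letter has only two possible positions, so arbitrarily long finite embeddings
    yield an infinite one. *)
Lemma seen2E (w y : word) : seen 2 w y <-> forall k, embeds w y 0 0 k.
Proof.
split=> [[m [m0 mP]] k|all_k].
  suff H i : embeds w y i (m i) k by have := H 0%N; rewrite m0.
  elim: k i => [//|k IHk] i /=; have [+ ym] := mP i; have := IHk i.+1.
  move: ym; have [->|] :
      m i.+1 = (m i).+1 \/ (m i.+1 = (m i).+2 \/ ~~ (m i < m i.+1 <= m i + 2)%N)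
    by lia.
    by move=> /= -> ->; rewrite eqxx.
  case=> [->|/negPf->//].
  by move=> /= -> ->; rewrite eqxx orbT.
(* The default [m] is never reached: by [mP], every pair [(i, m i)] met by the recursion extends to
   all lengths. *)
pose next i m := if pselect (forall k, embeds w y i m k) is left h
  then projT1 (cid2 (embeds_all _ _ _ _ h)) else m.
pose fix m i := if i is i'.+1 then next i' (m i') else 0%N.
have nextP i n : (forall k, embeds w y i n k) ->
  [/\ (n < next i n <= n + 2)%N, y (next i n).-1 = w i &
      forall k, embeds w y i.+1 (next i n) k].
  by move=> h; rewrite /next; case: pselect => // h'; case: cid2 => /= ? ? [].
have mP i : forall k, embeds w y i (m i) k.
  by elim: i => [//|i /nextP[]].
by exists m; split=> // i; have [] := nextP _ _ (mP i).
Qed.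

(** * The set-valued process, its weight and its survival *)

Local Open Scope fset_scope.

(* The pair (A_(m-1), A_m). *)
Definition state : Type := ({fset nat} * {fset nat})%type.

Definition step (w : word) (s : state) (b : bool) : state :=
  (s.2, [fset i.+1 | i in s.1 `|` s.2 & w i == b]).

Definition init : state := (fset0, [fset 0%N]).

(** With values in [nat], its iterated [branch] counts the letter strings that the process
    survives. *)
Definition alive (s : state) : nat := (s != (fset0, fset0)).

Definition weight (s : state) : nat := #|` s.1| + #|` s.2|.*2.

Definition overlap (s : state) : nat := #|` s.1 `&` s.2|.

(* Twice the expectation of [f] after one step, to remain in [nat]. *)
Definition branch (w : word) (f : state -> nat) (s : state) : nat :=
  f (step w s true) + f (step w s false).

Lemma branchE (w : word) (f : state -> nat) (s : state) :
  branch w f s = (f (step w s true) + f (step w s false))%N.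
Proof. by []. Qed.

Lemma in_step (w : word) (s : state) (i : nat) (b : bool) :
  (i.+1 \in (step w s b).2) = ((i \in s.1) || (i \in s.2)) && (w i == b).
Proof.
apply/imfsetP/idP => [[j /= + [->]]|h]; first by rewrite !inE.
by exists i => //=; rewrite !inE.
Qed.

Lemma alive0P (s : state) :
  reflect (s.1 = fset0 /\ s.2 = fset0) (alive s == 0%N).
Proof.
rewrite /alive eqb0 negbK; case: s => A B /=.
by apply: (iffP eqP) => [[-> ->]|[-> ->]].
Qed.

Lemma alive_mem1 (s : state) (i : nat) : i \in s.1 -> alive s = 1%N.
Proof.
case: s => A B /= iA; rewrite /alive; case: eqP => // -[A0].
by rewrite A0 in iA.
Qed.

Lemma alive_mem2 (s : state) (i : nat) : i \in s.2 -> alive s = 1%N.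
Proof.
case: s => A B /= iB; rewrite /alive; case: eqP => // -[_ B0].
by rewrite B0 in iB.
Qed.

Lemma alive_step (w : word) (s : state) (b : bool) :
  (alive (step w s b) <= alive s)%N.
Proof.
have [/eqP/alive0P[A0 B0]|] := posnP (alive s); last by rewrite /alive; lia.
suff /alive0P/eqP-> : (step w s b).1 = fset0 /\ (step w s b).2 = fset0 by [].
rewrite /step A0 B0; split=> //=; apply/fsetP => i.
by rewrite inE; apply/negbTE/imfsetP => -[j /=]; rewrite !inE.
Qed.

(** Each [i] in the union survives under exactly one letter, [w i], and the shift to [i.+1] is
    injective. *)
Lemma card_step (w : word) (s : state) :
  (#|` (step w s true).2| + #|` (step w s false).2| = #|` s.1 `|` s.2|)%N.
Proof.
rewrite !(card_imfset _ _ succn_inj) /= !size_filter.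
rewrite -(count_predC (fun i => w i == true)); congr addn.
by apply: eq_count => i /=; case: (w i).
Qed.

Lemma branch_weight (w : word) (s : state) :
  (branch w weight s + (overlap s).*2 = (weight s).*2)%N.
Proof.
rewrite /branch /weight /overlap.
have := card_step w s; have := cardfsUI s.1 s.2.
rewrite [(step _ _ _).1]/= /=; lia.
Qed.

Lemma branch_iter_le (w : word) (n : nat) (f g : state -> nat) :
  (forall s, f s <= g s)%N ->
  forall s, (iter n (branch w) f s <= iter n (branch w) g s)%N.
Proof. by move=> fg; elim: n => [//|n IHn] s /=; apply: leq_add. Qed.

Lemma branch_iter_linear (w : word) (n a b : nat) (f g : state -> nat)
    (s : state) :
  (iter n (branch w) (fun s => a * f s + b * g s) s =
   a * iter n (branch w) f s + b * iter n (branch w) g s)%N.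
Proof. by elim: n s => [//|n IHn] s /=; rewrite !branchE !IHn; lia. Qed.

(** Reading [w i] twice places [i.+1] in both new sets: [i] is available to the first step as an
    element of [s.2], and to the second as one of the older set. *)
Lemma branch2_overlap (w : word) (s : state) (i : nat) :
  i \in s.2 -> (0 < iter 2 (branch w) overlap s)%N.
Proof.
move=> is2.
suff : (0 < overlap (step w (step w s (w i)) (w i)))%N.
  by rewrite /= !branchE; case: (w i); lia.
rewrite /overlap cardfs_gt0; apply/fset0Pn; exists i.+1.
by rewrite in_fsetI !in_step /= is2 eqxx orbT.
Qed.

Lemma branch4_weight (w : word) (s : state) :
  (iter 4 (branch w) weight s + alive s <= 16 * weight s)%N.
Proof.
have W := branch_weight w.
have W2 t : (branch w (branch w weight) t + 2 * branch w overlap t +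
    4 * overlap t = 4 * weight t)%N.
  by have := W t; have := W (step w t true); have := W (step w t false);
    rewrite !branchE; lia.
(* Of the losses over four steps, only those due to overlaps after two and three steps are kept. *)
have W4 : (iter 4 (branch w) weight s + 2 * iter 3 (branch w) overlap s +
    4 * iter 2 (branch w) overlap s <= 16 * weight s)%N.
  have := W2 s.
  have := W2 (step w (step w s true) true).
  have := W2 (step w (step w s true) false).
  have := W2 (step w (step w s false) true).
  have := W2 (step w (step w s false) false).
  by rewrite /= !branchE; lia.
have a1 : (alive s <= 1)%N by rewrite /alive leq_b1.
have [s0|s_alive] := posnP (alive s); first by lia.
have [s2|[i is2]] := fset_0Vmem s.2; last first.
  by have := branch2_overlap w s i is2; lia.
(* When only the older set is nonempty, one more letter brings an element into the newer set, so the
   overlap comes at step three. *)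
have [s1|[i is1]] := fset_0Vmem s.1.
  by have /alive0P/eqP := conj s1 s2; lia.
have i_next : i.+1 \in (step w s (w i)).2 by rewrite in_step is1 eqxx.
have := branch2_overlap w _ _ i_next.
have : iter 3 (branch w) overlap s =
  (iter 2 (branch w) overlap (step w s true) +
   iter 2 (branch w) overlap (step w s false))%N by [].
by case: (w i); lia.
Qed.

(** Four steps multiply the number of strings by 16. The mean weight drops by at least 1/16 of the
    survival probability in each block, and this probability is nonincreasing, so the losses add
    up. *)
Lemma alive_iter_bound (w : word) (n : nat) (s : state) :
  (n * iter (4 * n) (branch w) alive s <= 16 ^ n.+1 * weight s)%N.
Proof.
(* The remaining weight is kept on the left, since the induction spends it on the next block. *)
suff : (16 * iter (4 * n) (branch w) weight s +
    n * iter (4 * n) (branch w) alive s <= 16 ^ n.+1 * weight s)%N by lia.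
elim: n => [|n IHn]; first by rewrite muln0 /=; lia.
have -> : (4 * n.+1 = 4 * n + 4)%N by lia.
rewrite !(iterD (4 * n)) (expnS 16 n.+1) -mulnA.
(* The null terms make [branch_iter_linear] apply below. *)
have alive4 t : (iter 4 (branch w) alive t <= 16 * alive t + 0 * alive t)%N.
  have A u : (branch w alive u <= 2 * alive u)%N.
    by have := alive_step w u true; have := alive_step w u false;
      rewrite !branchE; lia.
  have A2 u : (branch w (branch w alive) u <= 4 * alive u)%N.
    by have := A u; have := A (step w u true); have := A (step w u false);
      rewrite !branchE; lia.
  have := A2 t.
  have := A2 (step w (step w t true) true).
  have := A2 (step w (step w t true) false).
  have := A2 (step w (step w t false) true).
  have := A2 (step w (step w t false) false).
  by rewrite /= !branchE; lia.
have weight4 t : (1 * iter 4 (branch w) weight t + 1 * alive t <=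
    16 * weight t + 0 * alive t)%N.
  by have := branch4_weight w t; lia.
have := branch_iter_le w (4 * n) _ _ alive4 s.
have := branch_iter_le w (4 * n) _ _ weight4 s.
rewrite !branch_iter_linear.
set a := iter _ _ alive s in IHn *; set a' := iter _ _ (iter _ _ alive) s.
set z := iter _ _ weight s in IHn *; set z' := iter _ _ (iter _ _ weight) s.
move=> z'_le a'_le.
have : (n.+1 * a' <= n.+1 * (16 * a))%N by rewrite leq_mul2l; lia.
rewrite (mulnCA n.+1) !(mulSn n); lia.
Qed.

(** Embedding [k] letters of [w] takes at least [k] letters of [y], so the process cannot die before
    these are read. *)
Lemma embeds_alive (w y : word) (k i m : nat) (s : state) :
  i \in s.2 -> embeds w y i m k ->
  alive (foldl (step w) s [seq y j | j <- iota m k]) = 1%N.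
Proof.
elim: k i m s => [|k IHk] i m s is2 /=; first by rewrite (alive_mem2 _ _ is2).
case/orP=> /andP[/eqP yw ywk].
  by apply: IHk ywk; rewrite in_step is2 yw eqxx orbT.
case: k IHk ywk => [|k] IHk ywk /=; first exact: (alive_mem1 _ i).
set s' := step w _ _.
have is' : i.+1 \in s'.2 by rewrite in_step is2 yw eqxx.
have := IHk _ _ _ is' ywk.
(* After a move by two positions the induction hypothesis concerns one letter too many; being alive
   then implies being alive one letter earlier. *)
rewrite -[k.+1]addn1 iotaD map_cat foldl_cat /= => alive_last.
set t := foldl _ _ _ in alive_last *.
have := alive_step w t (y (m.+2 + k)%N); rewrite alive_last.
by rewrite /alive; case: (_ != _).
Qed.

(** * Measurability of events on finitely many letters *)

Local Open Scope ring_scope.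
Local Open Scope classical_set_scope.

Lemma measurable_Prop (d : measure_display) (T : measurableType d) (Q : Prop) :
  measurable [set _ : T | Q].
Proof.
have [q|nq] := pselect Q.
  by rewrite (_ : [set _ | _] = setT) //; apply/seteqP; split.
by rewrite (_ : [set _ | _] = set0) //; apply/seteqP; split.
Qed.

(** The measurable space is arbitrary, so that the sigma-algebra generated by a sequence can be used
    as well. *)
Lemma measurable_embeds (d : measure_display) (T : measurableType d)
    (w y : T -> word) (k i m : nat) :
  (forall i b, measurable [set t | w t i = b]) ->
  (forall i b, measurable [set t | y t i = b]) ->
  measurable [set t | embeds (w t) (y t) i m k].
Proof.
move=> mw my; elim: k i m => [|k IHk] i m /=.
  exact: measurable_Prop.
have m_match n : measurable [set t | y t n == w t i].
  rewrite (_ : [set t | _] =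
      ([set t | y t n = true] `&` [set t | w t i = true]) `|`
      ([set t | y t n = false] `&` [set t | w t i = false])).
    by apply: measurableU; apply: measurableI.
  apply/seteqP; split=> t /=; first by move/eqP->; case: (w t i); [left|right].
  by move=> [] [-> ->].
rewrite (_ : [set t | _] =
    ([set t | y t m == w t i] `&` [set t | embeds (w t) (y t) i.+1 m.+1 k]) `|`
    ([set t | y t m.+1 == w t i] `&` [set t | embeds (w t) (y t) i.+1 m.+2 k])).
  by apply: measurableU; apply: measurableI.
apply/seteqP; split=> t /=.
  by move=> /orP[] /andP[? ?]; [left|right].
by move=> [] [-> ->]; rewrite ?orbT.
Qed.

(** The property [a] is arbitrary because a prefix takes finitely many values; the induction splits
    on its last letter. *)
Lemma measurable_prefix (d : measure_display) (T : measurableType d)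
    (z : T -> word) (n : nat) (a : seq bool -> Prop) :
  (forall i b, measurable [set t | z t i = b]) ->
  measurable [set t | a (mkseq (z t) n)].
Proof.
move=> mz; elim: n a => [|n IHn] a.
  exact: (measurable_Prop _ _ (a [::])).
rewrite (_ : [set t | _] =
    ([set t | z t n = true] `&` [set t | a (rcons (mkseq (z t) n) true)]) `|`
    ([set t | z t n = false] `&` [set t | a (rcons (mkseq (z t) n) false)])).
  by apply: measurableU; apply: measurableI => //;
    apply: (IHn (fun u => a (rcons u _))).
apply/seteqP; split=> t; rewrite /= mkseqS.
  by case: (z t n); [left|right].
by move=> [] [->].
Qed.

(** * From counting strings to probabilities, for a fixed word *)

Section prefix_events.
Context {d : measure_display} {T : measurableType d} {R : realType}.
Context {P : probability T R}.
Implicit Types (Z : nat -> {RV P >-> bool}) (u : seq bool).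

Definition prefix_event Z u : set T :=
  [set t | mkseq (sample_word Z t) (size u) = u].

Lemma measurable_coordinate Z i b : measurable [set t | Z i t = b].
Proof.
rewrite (_ : [set t | _] = Z i @^-1` [set b]) //.
by rewrite -[_ @^-1` _]setTI; apply: measurable_funP.
Qed.

Lemma prefix_event_rcons Z u b :
  prefix_event Z (rcons u b) =
  prefix_event Z u `&` [set t | Z (size u) t = b].
Proof.
apply/seteqP; split=> t; rewrite /prefix_event /= size_rcons mkseqS.
  by move/rcons_inj => [].
by move=> [tu Zu]; rewrite tu /sample_word Zu.
Qed.

Lemma prefix_event_nil Z : prefix_event Z [::] = setT.
Proof. by apply/seteqP; split. Qed.

Lemma measurable_prefix_event Z u : measurable (prefix_event Z u).
Proof.
apply: (measurable_prefix _ _ (sample_word Z) _ (fun v => v = u)) => i b.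
exact: measurable_coordinate.
Qed.

Lemma prefix_event_split Z u (E : set T) : measurable E ->
  (P (prefix_event Z u `&` E) =
   P (prefix_event Z (rcons u true) `&` E) +
   P (prefix_event Z (rcons u false) `&` E))%E.
Proof.
move=> mE; rewrite -measureU; first last.
- apply/seteqP; split=> // t /=.
  rewrite !prefix_event_rcons /= => -[[[_ Zu] _] [[_ Zu'] _]].
  by rewrite Zu in Zu'.
- by apply: measurableI => //; apply: measurable_prefix_event.
- by apply: measurableI => //; apply: measurable_prefix_event.
congr (P _); apply/seteqP; split=> t; rewrite !prefix_event_rcons /=.
  by move=> [tu tE]; case: (boolP (Z (size u) t)) => [?|/negPf?];
    [left|right]; split=> //; split.
by move=> [] [[? _] ?]; split.
Qed.

Lemma iid_letter Z i b : iid_bernoulli_half Z ->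
  P (Z i @^-1` [set b]) = (2^-1)%:E.
Proof.
move=> [_ half]; case: b => //.
rewrite (_ : _ @^-1` _ = ~` (Z i @^-1` [set true])).
  rewrite probability_setC ?half -?EFinB; last exact: measurable_coordinate.
  by congr EFin; lra.
by apply/seteqP; split=> t /=; case: (Z i t).
Qed.

Lemma prefix_event_prob Z u : iid_bernoulli_half Z ->
  P (prefix_event Z u) = (2^-1 ^+ size u)%:E.
Proof.
move=> iidZ; have [indep half] := iidZ.
have := indep [fset i in iota 0 (size u)]%fset (fun i => [set nth false u i]).
rewrite (_ : \bigcap_(i in _) _ = prefix_event Z u); last first.
  apply/seteqP; split=> t; rewrite /prefix_event /= => tu.
    apply: (@eq_from_nth _ false); rewrite size_mkseq // => i iu.
    by rewrite nth_mkseq // /sample_word; apply: tu; rewrite /= !inE mem_iota.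
  move=> i /=; rewrite !inE mem_iota /= => iu.
  by have := nth_mkseq false (sample_word Z t) iu; rewrite tu.
move=> -> //; rewrite (eq_bigr (fun=> (2^-1)%:E)); last first.
  by move=> i _; apply: iid_letter.
rewrite big_const_seq count_predT.
have -> : size [fset i in iota 0 (size u)]%fset = size u.
  by rewrite [LHS]card_fseq undup_id ?iota_uniq ?size_iota.
by elim: (size u) => [//|n IHn] /=; rewrite IHn exprS EFinM.
Qed.

Definition alive_event Z (w : word) n : set T :=
  [set t | alive (foldl (step w) init (mkseq (sample_word Z t) n)) = 1%N].

Lemma measurable_alive_event Z w n : measurable (alive_event Z w n).
Proof.
apply: (measurable_prefix _ _ (sample_word Z) _
  (fun u => alive (foldl _ _ u) = 1%N)) => i b.
exact: measurable_coordinate.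
Qed.

(** The iterated [branch] counts the surviving continuations of [u], and all full strings are
    equally likely; the induction splits on the next letter. *)
Lemma alive_event_prefix Z (w : word) n u : iid_bernoulli_half Z ->
  P (prefix_event Z u `&` alive_event Z w (size u + n)) =
  ((iter n (branch w) alive (foldl (step w) init u))%:R *
    2^-1 ^+ (size u + n))%:E.
Proof.
move=> iidZ; elim: n u => [|n IHn] u.
  rewrite addn0 /=; set s := foldl _ _ _.
  have [s0|] := posnP (alive s).
    rewrite s0 mul0r (_ : _ `&` _ = set0) ?measure0 //.
    apply/seteqP; split=> // t [/= tu].
    by rewrite /alive_event /= tu -/s s0.
  move=> s_alive; have s1 : alive s = 1%N by move: s_alive; rewrite /alive; lia.
  rewrite s1 mul1r -(prefix_event_prob Z) //.
  rewrite (_ : _ `&` _ = prefix_event Z u) //.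
  apply/seteqP; split=> t; first by case.
  by move=> tu; split => //; rewrite /alive_event /= tu.
rewrite prefix_event_split; last exact: measurable_alive_event.
have E b : (size u + n.+1 = size (rcons u b) + n)%N.
  by rewrite size_rcons addSnnS.
rewrite {1}(E true) {1}(E false) !IHn -EFinD -!E !foldl_rcons /=.
by rewrite branchE natrD mulrDl.
Qed.

Definition embeds_event Z (w : word) k : set T :=
  [set t | embeds w (sample_word Z t) 0 0 k].

Lemma measurable_embeds_event Z w k : measurable (embeds_event Z w k).
Proof.
apply: (measurable_embeds _ _ (fun=> w)) => i b;
  last exact: measurable_coordinate.
by apply: measurable_Prop.
Qed.

(** The constant 32 is 16 times the initial weight 2. *)
Lemma embeds_event_le Z (w : word) n : iid_bernoulli_half Z ->
  (P (embeds_event Z w (4 * n.+1)) <= (32%:R / n.+1%:R)%:E)%E.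
Proof.
move=> iidZ; apply: (@le_trans _ _ (P (alive_event Z w (4 * n.+1)))).
  apply: le_measure; rewrite ?inE; first exact: measurable_embeds_event.
    exact: measurable_alive_event.
  by move=> t; apply: embeds_alive; rewrite inE.
have := alive_event_prefix Z w (4 * n.+1) [::] iidZ.
rewrite prefix_event_nil setTI add0n => ->; rewrite lee_fin.
have := alive_iter_bound w n.+1 init.
set a := iter _ _ _ _.
have -> : weight init = 2%N by rewrite /weight /= cardfs1.
rewrite ler_pdivlMr ?ltr0n // exprVn /= -/a => a_le.
rewrite mulrAC ler_pdivrMr ?exprn_gt0 // -natrX -!natrM ler_nat.
by rewrite expnM (_ : 2 ^ 4 = 16)%N //; move: a_le; rewrite expnS; lia.
Qed.

End prefix_events.

(** * Random words and the limit *)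

Lemma sigma_of_measurable (d : measure_display) (T : measurableType d)
    (R : realType) (P : probability T R) (Z : nat -> {RV P >-> bool})
    (i : nat) (b : bool) :
  sigma_of Z [set t | Z i t = b].
Proof.
apply: sub_sigma_algebra; exists i => //; exists [set b] => //.
by rewrite setTI.
Qed.

Lemma sigma_of_prefix_event (d : measure_display) (T : measurableType d)
    (R : realType) (P : probability T R) (Z : nat -> {RV P >-> bool})
    (u : seq bool) :
  sigma_of Z (prefix_event Z u).
Proof.
apply: (@measurable_prefix _ (g_sigma_algebraType
  (\bigcup_i g_sigma_algebra_preimage (Z i))) (sample_word Z) (size u)
  (fun v => v = u)).
exact: sigma_of_measurable.
Qed.

Lemma sigma_of_embeds_event (d : measure_display) (T : measurableType d)
    (R : realType) (P : probability T R) (Z : nat -> {RV P >-> bool})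
    (w : word) (k : nat) :
  sigma_of Z (embeds_event Z w k).
Proof.
apply: (@measurable_embeds _ (g_sigma_algebraType
  (\bigcup_i g_sigma_algebra_preimage (Z i))) (fun=> w) (sample_word Z)).
  by move=> i b; apply: measurable_Prop.
exact: sigma_of_measurable.
Qed.

(** Here [m] is the number of letters of [X] still to be fixed. Once all are fixed, independence and
    the bound uniform in the word apply; the cases are then summed back. *)
Lemma embeds_random_le (d : measure_display) (T : measurableType d)
    (R : realType) (P : probability T R) (X Y : nat -> {RV P >-> bool})
    (n m : nat) (u : seq bool) :
  iid_bernoulli_half Y -> independent_sequences X Y ->
  (m + size u = 4 * n.+1)%N ->
  (P (prefix_event X u `&`
     [set t | embeds (sample_word X t) (sample_word Y t) 0 0 (4 * n.+1)]) <=
   P (prefix_event X u) * (32%:R / n.+1%:R)%:E)%E.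
Proof.
move=> iidY indep; elim: m u => [|m IHm] u um.
  (* The [false] letters that continue [u] are harmless: an embedding of this length reads only the
     letters of [u]. *)
  rewrite (_ : _ `&` _ =
      prefix_event X u `&` embeds_event Y (nth false u) (4 * n.+1)).
    rewrite indep; [|exact: sigma_of_prefix_event|exact: sigma_of_embeds_event].
    by apply: lee_wpmul2l => //; apply: embeds_event_le.
  have Xu t : prefix_event X u t -> embeds (sample_word X t) (sample_word Y t)
      0 0 (4 * n.+1) = embeds (nth false u) (sample_word Y t) 0 0 (4 * n.+1).
    move=> tu; apply: eq_embeds => j ju; have {}ju : (j < size u)%N by lia.
    by have := nth_mkseq false (sample_word X t) ju; rewrite tu => <-.
  by apply/seteqP; split=> t [tu E]; split=> //; move: E;
    rewrite /embeds_event /mkset (Xu _ tu).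
rewrite prefix_event_split; last first.
  by apply: measurable_embeds => i b; apply: measurable_coordinate.
have := prefix_event_split X u setT measurableT; rewrite !setIT => ->.
rewrite ge0_muleDl //; apply: leeD; apply: IHm; rewrite size_rcons; lia.
Qed.

Lemma null_event_seen (d : measure_display) (T : measurableType d)
    (R : realType) (P : probability T R) (w y : T -> word) :
  (forall i b, measurable [set t | w t i = b]) ->
  (forall i b, measurable [set t | y t i = b]) ->
  (forall n, P [set t | embeds (w t) (y t) 0 0 (4 * n.+1)] <=
     (32%:R / n.+1%:R)%:E)%E ->
  null_event P [set t | seen 2 (w t) (y t)].
Proof.
move=> mw my bound.
have -> : [set t | seen 2 (w t) (y t)] =
    \bigcap_k [set t | embeds (w t) (y t) 0 0 k].
  apply/seteqP; split=> t /=; first by move/seen2E => h k _; apply: h.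
  by move=> h; apply/seen2E => k; apply: h.
have mE k : measurable [set t | embeds (w t) (y t) 0 0 k].
  exact: measurable_embeds.
have mI : measurable (\bigcap_k [set t | embeds (w t) (y t) 0 0 k]).
  exact: bigcapT_measurable.
split=> //; set E := \bigcap_k _ in mI *.
have E_le n : (P E <= (32%:R / n.+1%:R)%:E)%E.
  apply: le_trans (bound n); apply: le_measure; rewrite ?inE //.
  by move=> t; apply.
apply/eqP; rewrite eq_le measure_ge0 andbT.
apply/lee_addgt0Pr => e e0; rewrite add0e.
(* This index [n] satisfies [n.+1 > 32 / e]. *)
apply: le_trans (E_le (Num.truncn (32%:R / e))) _; rewrite lee_fin.
by rewrite ler_pdivrMr ?ltr0n // mulrC -ler_pdivrMr // ltW // truncnS_gt.
Qed.

Theorem corollary2 (d : measure_display) (T : measurableType d) (R : realType)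
    (P : probability T R) (X Y : nat -> {RV P >-> bool}) :
  iid_bernoulli_half X -> iid_bernoulli_half Y -> independent_sequences X Y ->
  (forall W : word, null_event P [set t | seen 2 W (sample_word Y t)]) /\
  null_event P [set t | seen 2 (sample_word X t) (sample_word Y t)].
Proof.
move=> iidX iidY indep; split=> [W|].
  apply: (null_event_seen _ _ _ P (fun=> W) (sample_word Y)).
  - by move=> i b; apply: measurable_Prop.
  - exact: measurable_coordinate.
  - by move=> n; apply: embeds_event_le.
apply: (null_event_seen _ _ _ P (sample_word X) (sample_word Y)) => [||n];
  try exact: measurable_coordinate.
(* The empty prefix imposes no condition on [X]. *)
have := embeds_random_le _ _ _ P X Y n (4 * n.+1) [::] iidY indep (addn0 _).
by rewrite prefix_event_nil setTI probability_setT mul1e.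
Qed.
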